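(* Let $h>0$, and for $\beta>0$ let $C_{j0}$ be the first effective catastrophe time of the queue with catastrophe rate $\beta$ started from $j\in\mathbf E$. Then $$\lim_{\beta\to+\infty}E(C_{00})=\frac1h,\qquad \lim_{\beta\to+\infty}\beta E(C_{j0})=\begin{cases}1+\dfrac{b_0}{h}, & j=1,\\ 1, & j\ge2.\end{cases}$$
   Context: Let $\mathbf E=\{0,1,2,\dots\}$ and let $c\ge 1$ be an integer (the number of servers). Let $(b_j)_{j\ge0}$ be reals with $b_j\ge 0$ for $j\ne 1$, $0<-b_1=\sum_{j\ne1}b_j<\infty$, $b_0>0$ and $\sum_{j\ge2}b_j>0$. Let $h_j\ge0$ ($j\ge1$) with $0<h:=\sum_{j\ge1}h_j<\infty$. The queue with resurrection has conservative bounded $q$-matrix $\tilde Q$ on $\mathbf E$: for $i\ge1$, $\tilde q_{i,i-1}=\min(i,c)b_0$, $\tilde q_{ii}=b_1-[\min(i,c)-1]b_0$, $\tilde q_{ij}=b_{j-i+1}$ ($j\ge i+1$); $\tilde q_{00}=-h$, $\tilde q_{0j}=h_j$ ($j\ge1$); other entries $0$. The queue with resurrection and catastrophes of rate $\beta>0$ moves as $\tilde Q$ and in addition jumps from each state $i\ge1$ to $0$ at rate $\beta$ (an effective catastrophe); $C_{j0}$ is the first occurrence time of an effective catastrophe starting from $j$. Formally, let $\{M_t\}$ be the Markov chain on $\{-1,0,1,\dots\}$ with $q$-matrix whose off-diagonal entries among states of $\mathbf E$ are those of $\tilde Q$, with additional jumps from each $i\ge1$ to $-1$ at rate $\beta$,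 and $-1$ absorbing (conservative); $C_{j0}$ is the hitting time of $-1$ by $M$ with $M_0=j$. *)

(* Defs.v *)
From HB Require Import structures.
From mathcomp Require Import all_boot all_order all_algebra.
From mathcomp Require Import all_classical all_reals all_analysis.
Import Order.TTheory GRing.Theory Num.Theory.
Import numFieldNormedType.Exports.

Set Implicit Arguments.
Unset Strict Implicit.
Unset Printing Implicit Defensive.

Local Open Scope classical_set_scope.
Local Open Scope ring_scope.

(* Only times t >= 0 are meaningful; values at t < 0 are unconstrained. *)
Record transition_function (R : realType) (S : countType)
    (p : S -> S -> R -> R) : Prop := TransitionFunction {
  tf_ge0 : forall x y t, 0 <= t -> 0 <= p x y t ;
  tf_sum1 : forall x t, 0 <= t -> \esum_(y in setT) (p x y t)%:E = 1%E ;
  tf_0 : forall x y, p x y 0 = (x == y)%:R ;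
  tf_semigroup : forall x y s t, 0 <= s -> 0 <= t ->
    (p x y (s + t))%:E = \esum_(z in setT) (p x z s * p z y t)%:E ;
  tf_standard : forall x y, p x y t @[t --> 0^'+] --> ((x == y)%:R : R)
}.

Definition has_q_matrix (R : realType) (S : countType)
    (p : S -> S -> R -> R) (q : S -> S -> R) : Prop :=
  forall x y, (p x y t - (x == y)%:R) / t @[t --> 0^'+] --> q x y.

(* The field [mc_markov] is the Markov property with transition function [p],
   multiplied out so as not to condition on null events:
   P(M_{t_0} = x_0, ..., M_{t_{n+1}} = x_{n+1})
     = P(M_{t_0} = x_0, ..., M_{t_n} = x_n) p_{x_n x_{n+1}}(t_{n+1} - t_n).
   Paths are right-continuous for the discrete topology on [S]. *)
Record markov_process (R : realType) (S : countType) (d : measure_display)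
    (T : measurableType d) (P : probability T R) (M : R -> T -> S)
    (p : S -> S -> R -> R) (x0 : S) : Prop := MarkovProcess {
  mc_measurable : forall t x, 0 <= t -> measurable [set w | M t w = x] ;
  mc_right_continuous : forall w t, 0 <= t ->
    \forall s \near t^'+, M s w = M t w ;
  mc_start : P [set w | M 0 w = x0] = 1%E ;
  mc_markov : forall (n : nat) (t : nat -> R) (x : nat -> S),
    0 <= t 0%N -> (forall k, (k <= n)%N -> t k < t k.+1) ->
    P [set w | forall k, (k <= n.+1)%N -> M (t k) w = x k] =
    (P [set w | forall k, (k <= n)%N -> M (t k) w = x k] *
       (p (x n) (x n.+1) (t n.+1 - t n))%:E)%E
}.

Definition markov_chain (R : realType) (S : countType) (q : S -> S -> R)
    (d : measure_display) (T : measurableType d) (P : probability T R)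
    (M : R -> T -> S) (x0 : S) : Prop :=
  exists p : S -> S -> R -> R,
    [/\ transition_function p, has_q_matrix p q & markov_process P M p x0].

(* [+oo] when [x] is never reached. *)
Definition hitting_time (R : realType) (S : Type) (T : Type)
    (M : R -> T -> S) (x : S) (w : T) : \bar R :=
  ereal_inf [set t%:E | t in [set t : R | 0 <= t /\ M t w = x]].

(* [hsum] stands for the sum of the [h j], j >= 1; [h 0] is never used. *)
Definition resurrection_q (R : realType) (c : nat) (b h : nat -> R) (hsum : R)
    (i j : nat) : R :=
  if i == 0%N then (if j == 0%N then - hsum else h j)
  else if j.+1 == i then (minn i c)%:R * b 0%N
  else if j == i then b 1%N - ((minn i c)%:R - 1) * b 0%N
  else if (i < j)%N then b (j - i + 1)%N
  else 0.

(* The state space {-1, 0, 1, ...} is [option nat], with [None] for -1. *)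
Definition catastrophe_q (R : realType) (c : nat) (b h : nat -> R)
    (hsum beta : R) (x y : option nat) : R :=
  let kill (i : nat) : R := if i == 0%N then 0 else beta in
  match x, y with
  | None, _ => 0
  | Some i, None => kill i
  | Some i, Some j =>
      if i == j then resurrection_q c b h hsum i i - kill i
      else resurrection_q c b h hsum i j
  end.

(* Main.v *)
Require Import Defs.
From HB Require Import structures.
From mathcomp Require Import all_boot all_order all_algebra.
From mathcomp Require Import ring lra.
From mathcomp Require Import all_classical all_reals all_analysis.
From mathcomp Require Import measurable_realfun.
Import Order.TTheory GRing.Theory Num.Theory.
Import numFieldNormedType.Exports.

(** Fix [beta], write [o] for the absorbing catastrophe state and [u_i] for the
    mean catastrophe time from [i]. Formally the [u_i] solve the linear system
    [Q u = - 1] with [u_o = 0]: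

      [h u_0 = 1 + sum_j h_j u_j],
      [(beta + r_i) u_i = 1 + e_i u_0 + (jumps to busy states)] for [i >= 1],

    where [r_i] is the rate out of [i] without catastrophes and [e_i], equal to
    [b_0] for [i = 1] and to 0 for [i >= 2], is the rate from [i] to 0. Let [U]
    be the supremum of the [u_i] over the busy states [i >= 1]. The second
    equation near the supremum gives [beta U <= 1 + b_0 u_0], the first one
    [u_0 <= 1 / h + U], hence [U <= B] where [B = (1 + b_0 / h) / (beta - b_0)] is
    of order [1 / beta]. Therefore [u_0] lies between [1 / h] and [1 / h + B] and
    tends to [1 / h]; and, for [i >= 1], [beta u_i] lies between
    [beta (1 + e_i / h) / (beta + r_i)] and [1 + e_i / h + r_i B], both of which
    tend to [1 + e_i / h].

    This uses only inequalities in which finitely many rates occur, and these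
    follow from the entrywise derivatives of the transition function [p] at 0.
    Let [F_x(u)] be the integral from 0 to [u] of the survival probability
    [1 - p_xo(t)]. The semigroup property yields
    [F_x(u) <= s + sum_z p_xz(s) F_z(u)] for [s > 0]; one bounds [F_z(u)] by a
    constant for [z] outside a finite set, divides by [s] and lets [s] tend to 0
    ([truncated_time_generator_le]). The truncation at [u] is what makes the
    supremum finite and the argument above legitimate; the bound [B] that it
    gives does not depend on [u] ([truncated_time_busy_bound]). The reverse
    inequalities are obtained in the same way once the mean times are known to
    be finite ([mean_time_generator_ge]).

    Finally the expectation of the hitting time is the integral of its tail, and
    the tail at [t] is the survival probability, because paths are
    right-continuous and [o] is absorbing ([mean_hitting_time]). *)

Set Implicit Arguments.
Unset Strict Implicit.
Unset Printing Implicit Defensive.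

Local Open Scope classical_set_scope.
Local Open Scope ring_scope.

(** * Finite approximations of transition functions *)

Lemma bernoulli_le {R : realType} (a : R) (n : nat) :
  0 <= a <= 1 -> 1 - a *+ n <= (1 - a) ^+ n.
Proof.
move=> /andP[a0 a1]; elim: n => [|n IHn]; first by rewrite expr0 mulr0n subr0.
rewrite exprS; apply: (@le_trans _ _ ((1 - a) * (1 - a *+ n))).
  have : 0 <= a * (a *+ n) by rewrite mulr_ge0 ?mulrn_wge0.
  by rewrite mulrS; lra.
by rewrite ler_wpM2l// subr_ge0.
Qed.

Section transition_functions.
Context {R : realType} {S : countType} {p : S -> S -> R -> R}.
Hypothesis ptf : transition_function p.

Lemma transition_sum_le1 (x : S) (W : seq S) (t : R) :
  uniq W -> 0 <= t -> \sum_(z <- W) p x z t <= 1.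
Proof.
move=> uW t0; rewrite -lee_fin -(tf_sum1 ptf x t0); apply: esum_ge.
exists [set` W]; first by split; [exact: finite_seq|].
by rewrite -fsbig_seq// sumEFin.
Qed.

Lemma transition_sum_approx (x : S) (t e : R) :
  0 <= t -> 0 < e -> exists2 W : seq S, uniq W & 1 - e < \sum_(z <- W) p x z t.
Proof.
move=> t0 e0.
have : ((1 - e)%:E < \esum_(y in [set: S]) (p x y t)%:E)%E.
  by rewrite (tf_sum1 ptf)// lte_fin gtrBl.
move=> /ereal_sup_gt[_ [A [finA _] <-]].
rewrite fsbig_finite//= sumEFin lte_fin => ltA.
by exists (finmap.enum_fset (fset_set A)) => //; exact: finmap.fset_uniq.
Qed.

(** The finite approximation of the row sum can be made to contain any
    prescribed states, which lets those be treated exactly. *)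
Lemma transition_sum_approx_cat (x : S) (t e : R) (Z : seq S) :
  uniq Z -> 0 <= t -> 0 < e ->
  exists2 W : seq S, uniq (Z ++ W) & 1 - e < \sum_(z <- Z ++ W) p x z t.
Proof.
move=> uZ t0 e0; have [V uV ltV] := transition_sum_approx x t0 e0.
exists [seq z <- V | z \notin Z].
  rewrite cat_uniq uZ filter_uniq// andbT /=.
  by apply/hasPn => z; rewrite mem_filter => /andP[].
apply: lt_le_trans ltV _.
rewrite big_cat/= big_filter (bigID (fun z => z \in Z))/= lerD2r.
rewrite -big_filter (perm_big [seq z <- Z | z \in V])/=; last first.
  apply: uniq_perm; rewrite ?filter_uniq// => z.
  by rewrite !mem_filter andbC.
rewrite big_filter [leRHS](bigID (fun z => z \in V))/= lerDl.
by apply: sumr_ge0 => z _; exact: (tf_ge0 ptf).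
Qed.

Lemma transition_comp_ge (x y : S) (W : seq S) (s t : R) :
  uniq W -> 0 <= s -> 0 <= t ->
  \sum_(z <- W) p x z s * p z y t <= p x y (s + t).
Proof.
move=> uW s0 t0; rewrite -lee_fin (tf_semigroup ptf)//; apply: esum_ge.
exists [set` W]; first by split; [exact: finite_seq|].
by rewrite -fsbig_seq// sumEFin.
Qed.

Lemma transition_le1 (x y : S) (t : R) : 0 <= t -> p x y t <= 1.
Proof.
move=> t0; have := @transition_sum_le1 x [:: y] t erefl t0.
by rewrite big_seq1.
Qed.

Lemma transition_iter_ge (x : S) (t : R) (n : nat) :
  0 <= t -> p x x t ^+ n <= p x x (t *+ n).
Proof.
move=> t0; elim: n => [|n IHn]; first by rewrite expr0 mulr0n (tf_0 ptf) eqxx.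
have := @transition_comp_ge x x [:: x] t (t *+ n) erefl t0 (mulrn_wge0 _ t0).
rewrite big_seq1 -mulrS; apply: le_trans.
by rewrite exprS ler_wpM2l// (tf_ge0 ptf).
Qed.

(** Iterating the semigroup inequality bounds [p x x t] from below by the n-th
    power of [p x x (t / n)]. A vanishing derivative at 0 puts
    [p x x (t / n)] above [1 - e / n] for [n] large, and Bernoulli's inequality
    turns the n-th power of that into [1 - e]. *)
Lemma transition_absorbing (x : S) :
  (p x x t - 1) / t @[t --> 0^'+] --> (0 : R) ->
  forall t, 0 <= t -> p x x t = 1.
Proof.
move=> dp t; rewrite le_eqVlt => /predU1P[<-|t0].
  by rewrite (tf_0 ptf) eqxx.
apply/eqP; rewrite eq_le (transition_le1 _ _ (ltW t0))/=.
apply/ler_addgt0Pr => e e0.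
have et0 : 0 < e / t by rewrite divr_gt0.
have [d /= d0 dP] : \forall s \near 0^'+, `|0 - (p x x s - 1) / s| < e / t.
  by have /cvgrPdist_lt := dp; apply.
(* [n] is chosen so that [t / n.+1] lies in the neighbourhood of 0 where the
   difference quotient is below [e / t]. *)
have [n nd] : exists n : nat, t / n.+1%:R < d.
  exists (Num.truncn (t / d)).
  rewrite ltr_pdivrMr// -ltr_pdivrMl// mulrC.
  exact: truncnS_gt.
set s := t / n.+1%:R in nd.
have s0 : 0 < s by rewrite divr_gt0.
have /(_ s) := dP; rewrite /ball_ /= sub0r normrN gtr0_norm// => /(_ nd s0).
rewrite sub0r normrN normrM normfV (gtr0_norm s0) ltr_pdivrMr// => near1.
have ps : 1 - e / t * s <= p x x s.
  by move: near1; rewrite ltr_norml => /andP[+ _]; lra.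
have sn : s *+ n.+1 = t by rewrite -mulr_natr /s divfK// pnatr_eq0.
have -> : p x x t = p x x (s *+ n.+1) by rewrite sn.
suff : 1 - e <= p x x (s *+ n.+1) by lra.
apply: le_trans (transition_iter_ge x n.+1 (ltW s0)).
set a := e / t * s in ps *.
have a0 : 0 <= a by rewrite /a mulr_ge0// ltW.
have aE : a *+ n.+1 = e.
  by rewrite /a -mulrnAr sn divfK// gt_eqF.
have [a1|a1] := leP a 1.
  rewrite -[X in 1 - X]aE; apply: le_trans (bernoulli_le _ _) _.
    by rewrite a0.
  by rewrite lerXn2r ?nnegrE ?subr_ge0// (tf_ge0 ptf)// ltW.
apply: (@le_trans _ _ 0); last by rewrite exprn_ge0// (tf_ge0 ptf)// ltW.
by have := mulrn_wge0 n a0; rewrite subr_le0 -aE mulrS; lra.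
Qed.

End transition_functions.

(** * Integrals of survival probabilities *)

Lemma lebesgue_measure_translation {R : realType} (s : R) (A : set R) :
  measurable A ->
  pushforward (@lebesgue_measure R)
    ((fun t => s + t) : _ -> measurableTypeR R) A = lebesgue_measure A.
Proof.
move=> mA.
have ms : measurable_fun [set: measurableTypeR R]
    ((fun t => s + t) : measurableTypeR R -> measurableTypeR R).
  exact: measurable_funD.
pose ms_mixin := isMeasurableFun.Build _ _ _ _ _ ms.
pose ms_pack : {mfun measurableTypeR R >-> measurableTypeR R} :=
  HB.pack (fun t : R => s + t) ms_mixin.
apply/esym.
apply: (@lebesgue_measure_unique _
  (pushforward (@lebesgue_measure R) ms_pack)) => //=.
move=> _ [[a b]] _ <-.
rewrite /pushforward (_ : (_ @^-1` _) = `]a - s, b - s]%classic); last first.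
  by apply/seteqP; split => t /=; rewrite !in_itv/= ltrBlDl lerBrDl.
rewrite !lebesgue_measure_itv/= !lte_fin ltrD2r.
by case: ifPn => // _; rewrite -!EFinD opprB addrA subrK.
Qed.

Lemma ge0_integral_translation {R : realType} (s u : R) (f : R -> \bar R) :
  measurable_fun [set: R] f -> (forall t, 0 <= f t)%E ->
  (\int[lebesgue_measure]_(t in `[s, (s + u)%R]) f t =
   \int[lebesgue_measure]_(t in `[0%R, u]) f (s + t)%R)%E.
Proof.
move=> mf f0.
have ms : measurable_fun [set: measurableTypeR R]
    ((fun t => s + t) : measurableTypeR R -> measurableTypeR R).
  exact: measurable_funD.
have -> : `[0, u]%classic = ((fun t => s + t) : _ -> measurableTypeR R)
    @^-1` `[s, (s + u)]%classic.
  by apply/seteqP; split => t /=; rewrite !in_itv/= lerDl lerD2l.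
rewrite -(@ge0_integral_pushforward _ _ _ _ _ _ ms _ _ f)//; last first.
  exact: measurable_funS mf.
apply: eq_measure_integral => A mA _; exact/esym/lebesgue_measure_translation.
Qed.

(** Probability of not being absorbed in [o] by time [t], from [x]. Clamping [t]
    at 0 makes this nonincreasing, hence measurable, on the whole line, although
    [p] is arbitrary at negative times. *)
Definition survival {R : realType} {S : countType} (p : S -> S -> R -> R)
    (o x : S) (t : R) : R :=
  1 - p x o (Num.max 0 t).

(** Expectation of the minimum of [u] and of the absorption time in [o], from
    [x]. Being at most [u], it can be subtracted and has a finite supremum over
    [x] before anything is known on [mean_time]. *)
Definition truncated_time {R : realType} {S : countType}
    (p : S -> S -> R -> R) (o x : S) (u : R) : R :=
  fine (\int[lebesgue_measure]_(t in `[0%R, u]) (survival p o x t)%:E)%E.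

(** Expected absorption time in [o], from [x], as the integral of the tail. *)
Definition mean_time {R : realType} {S : countType}
    (p : S -> S -> R -> R) (o x : S) : \bar R :=
  (\int[lebesgue_measure]_(t in `[0%R, +oo[) (survival p o x t)%:E)%E.

Section survival.
Context {R : realType} {S : countType} {p : S -> S -> R -> R}.
Hypothesis ptf : transition_function p.
Variable o : S.
Hypothesis o_absorbing : forall t, 0 <= t -> p o o t = 1.

Local Notation f := (survival p o).
Local Notation F := (truncated_time p o).
Local Notation mu := (@lebesgue_measure R).

Lemma survivalE x t : 0 <= t -> f x t = 1 - p x o t.
Proof. by move=> t0; rewrite /survival max_r. Qed.

Lemma survival_absorbing t : f o t = 0.
Proof. by rewrite /survival o_absorbing ?subrr// le_max lexx. Qed.

Lemma survival_ge0 x t : 0 <= f x t.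
Proof. by rewrite subr_ge0 (transition_le1 ptf)// le_max lexx. Qed.

Lemma survival_le1 x t : f x t <= 1.
Proof. by rewrite lerBlDr lerDl (tf_ge0 ptf)// le_max lexx. Qed.

Lemma survival_nonincreasing x : nonincreasing_fun (f x).
Proof.
move=> s t st; rewrite /survival lerD2l lerN2.
set s' := Num.max 0 s; set t' := Num.max 0 t.
have s'0 : 0 <= s' by rewrite le_max lexx.
have st' : s' <= t'.
  by rewrite ge_max le_max lexx /= le_max st orbT.
have := @transition_comp_ge _ _ _ ptf x o [:: o] s' (t' - s') erefl s'0.
rewrite subr_ge0 => /(_ st').
by rewrite big_seq1 o_absorbing ?subr_ge0// mulr1 addrC subrK.
Qed.

Lemma measurable_survival x : measurable_fun [set: R] (f x).
Proof.
by apply: nonincreasing_measurable => //; exact: survival_nonincreasing.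
Qed.

Lemma measurable_survival_EFin x (D : set R) : measurable D ->
  measurable_fun D (fun t => (f x t)%:E).
Proof.
move=> mD; apply/measurable_EFinP.
exact: measurable_funS (measurable_survival x).
Qed.

Lemma survival_ge_diag x t : x != o -> 0 <= t -> p x x t <= f x t.
Proof.
move=> xo t0; rewrite survivalE// lerBrDr.
have := @transition_sum_le1 _ _ _ ptf x [:: x; o] t _ t0.
by rewrite /= inE xo => /(_ erefl); rewrite big_cons big_seq1.
Qed.

(** Apply the semigroup inequality to the column of [o] and substitute
    [p z o t = 1 - f z t]. *)
Lemma survival_step_le x (W : seq S) s t : uniq W -> 0 <= s -> 0 <= t ->
  f x (s + t) <= \sum_(z <- W) p x z s * f z t + (1 - \sum_(z <- W) p x z s).
Proof.
move=> uW s0 t0; rewrite survivalE ?addr_ge0//.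
have := transition_comp_ge ptf x o uW s0 t0.
rewrite (eq_bigr (fun z => p x z s - p x z s * f z t)); last first.
  by move=> z _; rewrite survivalE//; ring.
by rewrite sumrB; lra.
Qed.

(** Summing [p x z s * p z o t + p x z s * f z t = p x z s] over all [z] gives
    [f x (s + t)] as the full sum of the [p x z s * f z t]; a finite part of it
    is smaller. *)
Lemma survival_step_ge x (W : seq S) s t : uniq W -> 0 <= s -> 0 <= t ->
  \sum_(z <- W) p x z s * f z t <= f x (s + t).
Proof.
move=> uW s0 t0.
have fE : (\esum_(z in [set: S]) (p x z s * f z t)%:E = (f x (s + t))%:E)%E.
  have := tf_sum1 ptf x s0.
  rewrite (@eq_esum _ _ _ _ (fun z => (p x z s * p z o t)%:E +
    (p x z s * f z t)%:E)%E); last first.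
    by move=> z _; rewrite -EFinD survivalE//; congr EFin; ring.
  rewrite esumD; last 2 first.
  - by move=> z _; rewrite lee_fin mulr_ge0// (tf_ge0 ptf).
  - by move=> z _; rewrite lee_fin mulr_ge0 ?survival_ge0// (tf_ge0 ptf).
  rewrite -(tf_semigroup ptf)// survivalE ?addr_ge0// EFinB => <-.
  by rewrite [X in (X - _)%E]addeC addeK.
rewrite -lee_fin -fE; apply: esum_ge.
exists [set` W]; first by split; [exact: finite_seq|].
by rewrite -fsbig_seq// sumEFin.
Qed.


Lemma integral_survival_bound x s u : 0 <= s -> 0 <= u ->
  (0 <= \int[mu]_(t in `[0%R, u]) (f x (s + t))%:E <= u%:E)%E.
Proof.
move=> s0 u0; apply/andP; split.
  by apply: integral_ge0 => t _; rewrite lee_fin survival_ge0.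
have -> : u%:E = (\int[mu]_(t in `[0%R, u]) (cst 1 t))%E.
  rewrite integral_cst//= lebesgue_measure_itv/= lte_fin mul1e.
  by have [u1|u1] := ltP 0 u; [rewrite sube0|congr EFin; apply/le_anti/andP].
apply: ge0_le_integral => //.
- by move=> t _; rewrite lee_fin survival_ge0.
- apply/measurable_EFinP; apply: measurableT_comp; first exact: measurable_survival.
  exact: measurable_funD.
- by move=> t _; rewrite lee_fin survival_le1.
Qed.

Lemma truncated_time_integral x u : 0 <= u ->
  (\int[mu]_(t in `[0%R, u]) (f x t)%:E)%E = (F x u)%:E.
Proof.
move=> u0; rewrite fineK//.
have := @integral_survival_bound x 0 u (lexx _) u0.
under eq_integral do rewrite add0r.
by move=> /andP[i0 iu]; rewrite ge0_fin_numE// (le_lt_trans iu) ?ltry.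
Qed.

Lemma truncated_time_bound x u : 0 <= u -> 0 <= F x u <= u.
Proof.
move=> u0; have := @integral_survival_bound x 0 u (lexx _) u0.
under eq_integral do rewrite add0r.
by rewrite truncated_time_integral// !lee_fin.
Qed.

Lemma truncated_time_absorbing u : 0 <= u -> F o u = 0.
Proof.
move=> u0; rewrite /truncated_time integral0_eq// => t _.
by rewrite survival_absorbing.
Qed.

Lemma truncated_time_split x s u : 0 <= s -> 0 <= u ->
  (F x (s + u))%:E =
    ((F x s)%:E + \int[mu]_(t in `[0%R, u]) (f x (s + t)%R)%:E)%E.
Proof.
move=> s0 u0; rewrite -!truncated_time_integral ?addr_ge0//.
rewrite -(@ge0_integral_translation R s u (fun t => (f x t)%:E)); last 2 first.
- exact: measurable_survival_EFin.
- by move=> t; rewrite lee_fin survival_ge0.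
rewrite -[X in _ = (X + _)%E]integral_itv_bndo_bndc; last first.
  exact: measurable_survival_EFin.
rewrite -ge0_integral_setU//=; last 3 first.
- by apply: measurable_survival_EFin; exact: measurableU.
- by move=> t _; rewrite lee_fin survival_ge0.
- apply/disj_setPS => t /= []; rewrite !in_itv/= => /andP[_ ts] /andP[st _].
  by move: ts; rewrite ltNge st.
by rewrite -itv_bndbnd_setU// bnd_simp// lerDl.
Qed.

Lemma truncated_time_nondecreasing x u v : 0 <= u -> u <= v -> F x u <= F x v.
Proof.
move=> u0 uv; rewrite -lee_fin -[v](subrK u) addrC.
rewrite truncated_time_split ?subr_ge0// leeDl//.
by apply: integral_ge0 => t _; rewrite lee_fin survival_ge0.
Qed.

Lemma integral_survival_sum x (W : seq S) s u c : 0 <= s -> 0 <= u -> 0 <= c ->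
  (\int[mu]_(t in `[0%R, u]) (\sum_(z <- W) p x z s * f z t + c)%R%:E)%E =
    (\sum_(z <- W) p x z s * F z u + c * u)%:E.
Proof.
move=> s0 u0 c0.
under eq_integral do rewrite EFinD -sumEFin.
have mf z : measurable_fun `[0%R, u] (fun t => (p x z s * f z t)%:E).
  apply/measurable_EFinP; apply: measurable_funM => //.
  exact: measurable_funS (measurable_survival z).
have f0 z t : (0 <= (p x z s * f z t)%:E)%E.
  by rewrite lee_fin mulr_ge0 ?survival_ge0// (tf_ge0 ptf).
rewrite ge0_integralD//=; last 2 first.
- by move=> t _; apply: sume_ge0.
- exact: emeasurable_sum.
rewrite ge0_integral_sum// EFinD -sumEFin; congr (_ + _)%E.
  apply: eq_bigr => z _; under eq_integral do rewrite EFinM.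
  rewrite ge0_integralZl_EFin ?(tf_ge0 ptf)//; last 2 first.
  - by move=> t _; rewrite lee_fin survival_ge0.
  - exact: measurable_survival_EFin.
  by rewrite truncated_time_integral// EFinM.
rewrite integral_cst//= lebesgue_measure_itv/= lte_fin.
have [u1|u1] := ltP 0 u; first by rewrite sube0.
by have -> : u = 0 by [apply/le_anti/andP]; rewrite mulr0 mule0.
Qed.

(** The first [s] units of time count for at most [s], and the trajectories
    that are outside [W] at time [s] for at most [u] afterwards. *)
Lemma truncated_time_step_le x (W : seq S) s u :
  uniq W -> 0 <= s -> 0 <= u ->
  F x (s + u) <=
    s + \sum_(z <- W) p x z s * F z u + (1 - \sum_(z <- W) p x z s) * u.
Proof.
move=> uW s0 u0; rewrite -lee_fin truncated_time_split// -addrA EFinD.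
have W1 : 0 <= 1 - \sum_(z <- W) p x z s.
  by rewrite subr_ge0 (transition_sum_le1 ptf).
apply: leeD; first by have /andP[] := truncated_time_bound x s0; rewrite lee_fin.
rewrite -integral_survival_sum//; apply: ge0_le_integral => //.
- by move=> t _; rewrite lee_fin survival_ge0.
- apply/measurable_EFinP; apply: measurableT_comp; first exact: measurable_survival.
  exact: measurable_funD.
- apply/measurable_EFinP; apply: measurable_funD => //.
  apply: measurable_sum => z; apply: measurable_funM => //.
  exact: measurable_funS (measurable_survival z).
- move=> t; rewrite /= in_itv/= => /andP[t0 _].
  by rewrite lee_fin survival_step_le.
Qed.

(** The term [s * p x x s] comes from [f x t >= f x s >= p x x s] for [t <= s];
    divided by [s] it tends to 1 as [s] tends to 0. *)
Lemma truncated_time_step_ge x (W : seq S) s u : x != o ->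
  uniq W -> 0 <= s -> 0 <= u ->
  s * p x x s + \sum_(z <- W) p x z s * F z u <= F x (s + u).
Proof.
move=> xo uW s0 u0; rewrite -lee_fin truncated_time_split// EFinD.
apply: leeD.
  rewrite -truncated_time_integral//.
  have -> : (s * p x x s)%:E = (\int[mu]_(t in `[0%R, s]) (cst (p x x s)%:E t))%E.
    rewrite integral_cst//= lebesgue_measure_itv/= lte_fin.
    have [s1|s1] := ltP 0 s; first by rewrite sube0 EFinM muleC.
    by have -> : s = 0 by [apply/le_anti/andP]; rewrite mul0r mule0.
  apply: ge0_le_integral => //.
  - by move=> t _; rewrite lee_fin (tf_ge0 ptf).
  - exact: measurable_survival_EFin.
  - move=> t; rewrite /= in_itv/= lee_fin => /andP[t0 ts].
    apply: le_trans (survival_ge_diag xo s0) _.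
    exact: survival_nonincreasing.
rewrite -[X in X%:E]addr0 -[X in (_ + X)%:E](mul0r u) -integral_survival_sum//.
apply: ge0_le_integral => //.
- move=> t _; rewrite lee_fin addr0 sumr_ge0// => z _.
  by rewrite mulr_ge0 ?survival_ge0// (tf_ge0 ptf).
- apply/measurable_EFinP; apply: measurable_funD => //.
  apply: measurable_sum => z; apply: measurable_funM => //.
  exact: measurable_funS (measurable_survival z).
- apply/measurable_EFinP; apply: measurableT_comp; first exact: measurable_survival.
  exact: measurable_funD.
- move=> t; rewrite /= in_itv/= => /andP[t0 _].
  by rewrite lee_fin addr0 survival_step_ge.
Qed.

End survival.

(** * Inequalities between mean absorption times and the q-matrix *)

Section absorption_time.
Context {R : realType} {S : countType} {p : S -> S -> R -> R}.
Context {q : S -> S -> R}.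
Hypothesis ptf : transition_function p.
Hypothesis pq : has_q_matrix p q.
Variable o : S.
Hypothesis o_absorbing : forall t, 0 <= t -> p o o t = 1.

Local Notation f := (survival p o).
Local Notation F := (truncated_time p o).
Local Notation mu := (@lebesgue_measure R).

Lemma cvg_jump_rate (x z : S) : x != z ->
  p x z s / s @[s --> 0^'+] --> q x z.
Proof.
move=> xz; have := @pq x z.
by rewrite (negbTE xz); under eq_fun do rewrite subr0.
Qed.

Lemma cvg_jump_rates (x : S) (Z : seq S) (w : S -> R) : x \notin Z ->
  \sum_(z <- Z) p x z s / s * w z @[s --> 0^'+] --> \sum_(z <- Z) q x z * w z.
Proof.
move=> xZ; rewrite big_seq; under eq_fun do rewrite big_seq.
apply: cvg_big => [|z zZ]; first exact: add_continuous.
apply: cvgM; last exact: cvg_cst.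
by apply: cvg_jump_rate; apply: contraNneq xZ => ->.
Qed.

Lemma cvg_exit_rate (x : S) :
  (1 - p x x s) / s @[s --> 0^'+] --> - q x x.
Proof.
rewrite [X in X @ _](_ : _ = - (fun s => (p x x s - (x == x)%:R) / s)).
  by apply: cvgN; exact: pq.
by apply/funext => s; rewrite /= eqxx fctE -mulNr opprB.
Qed.

(** Once a finite set [W] containing [Z] carries almost all of the row sum, the
    cost [u] of the trajectories outside [W] is negligible, and [U] serves on the
    rest of [W]. *)
Lemma truncated_time_sup_step (x : S) (Z : seq S) (s u U : R) :
  uniq Z -> 0 <= s -> 0 <= u -> 0 <= U ->
  (forall z, z \notin Z -> F z u <= U) ->
  F x u <= s + \sum_(z <- Z) p x z s * F z u
             + (1 - \sum_(z <- Z) p x z s) * U.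
Proof.
move=> uZ s0 u0 U0 FU; apply/ler_addgt0Pr => e e0.
have u1 : 0 < 1 + u by rewrite ltr_pwDl.
have p0 z : 0 <= p x z s by exact: (tf_ge0 ptf).
have [V uV ltV] := transition_sum_approx_cat ptf x uZ s0 (divr_gt0 e0 u1).
have V1 := transition_sum_le1 ptf x uV s0.
have FV : \sum_(z <- V) p x z s * F z u <= (\sum_(z <- V) p x z s) * U.
  rewrite mulr_suml !big_seq; apply: ler_sum => z zV.
  rewrite ler_wpM2l// FU//; move: uV; rewrite cat_uniq => /and3P[_ /hasPn + _].
  exact.
have eu : (1 - \sum_(z <- Z ++ V) p x z s) * u <= e.
  apply: (@le_trans _ _ (e / (1 + u) * u)).
    by rewrite ler_wpM2r//; lra.
  by rewrite -mulrA ger_pMr// mulrC ler_pdivrMr// mul1r lerDr.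
have := truncated_time_step_le ptf o_absorbing x uV s0 u0.
have := truncated_time_nondecreasing ptf o_absorbing x u0 (_ : u <= s + u).
rewrite lerDr => /(_ s0).
rewrite !big_cat/= in V1 eu *.
set a := \sum_(z <- Z) p x z s in V1 eu *.
set b := \sum_(z <- V) p x z s in V1 eu FV *.
have abU : b * U <= (1 - a) * U by rewrite ler_wpM2r//; lra.
lra.
Qed.

(** Subtract the diagonal term, divide by [s] and let [s] tend to 0: only the
    finitely many rates from [x] to [Z] and the exit rate appear, so entrywise
    derivatives of [p] at 0 suffice. *)
Lemma truncated_time_generator_le (x : S) (Z : seq S) (u U : R) :
  uniq Z -> x \notin Z -> 0 <= u -> 0 <= U ->
  (forall z, z != x -> z \notin Z -> F z u <= U) ->
  - q x x * F x u <=
    1 + \sum_(z <- Z) q x z * F z u + (- q x x - \sum_(z <- Z) q x z) * U.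
Proof.
move=> uZ xZ u0 U0 FU.
have cl : (1 - p x x s) / s * F x u @[s --> 0^'+] --> - q x x * F x u.
  by apply: cvgM; [exact: cvg_exit_rate|exact: cvg_cst].
have cr : 1 + \sum_(z <- Z) p x z s / s * F z u
      + ((1 - p x x s) / s - \sum_(z <- Z) p x z s / s * 1) * U @[s --> 0^'+] -->
    1 + \sum_(z <- Z) q x z * F z u
      + (- q x x - \sum_(z <- Z) q x z * 1) * U.
  apply: cvgD; [apply: cvgD; [exact: cvg_cst|exact: cvg_jump_rates]|].
  apply: cvgM; last exact: cvg_cst.
  by apply: cvgB; [exact: cvg_exit_rate|exact: cvg_jump_rates].
have -> : \sum_(z <- Z) q x z = \sum_(z <- Z) q x z * 1.
  by apply: eq_bigr => z _; rewrite mulr1.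
apply: (ler_cvg_to cl cr); near=> s.
have s0 : 0 < s by [].
have := @truncated_time_sup_step x (x :: Z) s u U.
rewrite /= xZ uZ => /(_ erefl (ltW s0) u0 U0) sup_step.
rewrite -(ler_pM2r s0).
have {}sup_step := sup_step _.
move: sup_step; rewrite !big_cons => sup_step.
have -> : \sum_(z <- Z) p x z s / s * F z u =
    (\sum_(z <- Z) p x z s * F z u) / s.
  by rewrite mulr_suml; apply: eq_bigr => z _; rewrite mulrAC.
have -> : \sum_(z <- Z) p x z s / s * 1 = (\sum_(z <- Z) p x z s) / s.
  by rewrite mulr_suml; apply: eq_bigr => z _; rewrite mulr1.
set a := \sum_(z <- Z) p x z s in sup_step *.
set b := \sum_(z <- Z) p x z s * F z u in sup_step *.
have -> : (1 - p x x s) / s * F x u * s = (1 - p x x s) * F x u.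
  by field; rewrite gt_eqF.
have -> : (1 + b / s + ((1 - p x x s) / s - a / s) * U) * s =
    s + b + (1 - p x x s - a) * U.
  by field; rewrite gt_eqF.
suff : F x u <= s + (p x x s * F x u + b) + (1 - (p x x s + a)) * U by lra.
apply: sup_step => z; rewrite inE negb_or => /andP[zx zZ].
exact: FU.
Unshelve. all: by end_near. Qed.

Lemma cvg_truncated_time (x : S) :
  (F x n%:R)%:E @[n --> \oo] --> mean_time p o x.
Proof.
rewrite /mean_time.
have -> : `[0%R, +oo[%classic = \bigcup_n `[0%R, n%:R]%classic :> set R.
  apply/seteqP; split => t /=; rewrite in_itv/=.
    rewrite andbT => t0; exists (Num.truncn t).+1 => //=.
    by rewrite in_itv/= t0 ltW// truncnS_gt.
  by move=> [n _] /=; rewrite in_itv/= => /andP[-> _].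
under eq_fun do rewrite -truncated_time_integral//.
apply: ge0_nondecreasing_set_cvg_integral => //.
- move=> m n mn; apply/subsetPset => t /=; rewrite !in_itv/= => /andP[-> tm] /=.
  by rewrite (le_trans tm)// ler_nat.
- by move=> n; exact: measurable_survival_EFin.
- by move=> n t _; rewrite lee_fin survival_ge0.
Qed.

Lemma truncated_time_le_mean (x : S) (u : R) : 0 <= u ->
  ((F x u)%:E <= mean_time p o x)%E.
Proof.
move=> u0; rewrite -truncated_time_integral//; apply: ge0_subset_integral => //.
- exact: measurable_survival_EFin.
- by move=> t _; rewrite lee_fin survival_ge0.
- by move=> t /=; rewrite !in_itv/= => /andP[->].
Qed.

Lemma mean_time_le (x : S) (B : R) :
  (forall u, 0 <= u -> F x u <= B) -> (mean_time p o x <= B%:E)%E.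
Proof.
move=> FB; rewrite -(cvg_lim _ (@cvg_truncated_time x))//.
apply: lime_le.
  by apply/cvg_ex; exists (mean_time p o x); exact: cvg_truncated_time.
by near=> n; rewrite lee_fin FB.
Unshelve. all: by end_near. Qed.

(** Let the horizon tend to infinity first, then divide by [s] and let [s] tend
    to 0. *)
Lemma mean_time_generator_ge (x : S) (Z : seq S) (v : S -> R) :
  x != o -> uniq Z -> x \notin Z -> (forall z, mean_time p o z = (v z)%:E) ->
  1 + \sum_(z <- Z) q x z * v z <= - q x x * v x.
Proof.
move=> xo uZ xZ mv.
have cF z : F z n%:R @[n --> \oo] --> v z.
  by have := @cvg_truncated_time z; rewrite mv => /fine_cvgP[].
have cl : p x x s + \sum_(z <- Z) p x z s / s * v z @[s --> 0^'+] -->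
    1 + \sum_(z <- Z) q x z * v z.
  apply: cvgD; last exact: cvg_jump_rates.
  by have := @tf_standard _ _ _ ptf x x; rewrite eqxx.
have cr : (1 - p x x s) / s * v x @[s --> 0^'+] --> - q x x * v x.
  by apply: cvgM; [exact: cvg_exit_rate|exact: cvg_cst].
apply: (ler_cvg_to cl cr); near=> s.
have s0 : 0 < s by [].
have : s * p x x s + \sum_(z <- x :: Z) p x z s * v z <= v x.
  have c1 : s * p x x s + \sum_(z <- x :: Z) p x z s * F z n%:R @[n --> \oo] -->
      s * p x x s + \sum_(z <- x :: Z) p x z s * v z.
    apply: cvgD; first exact: cvg_cst.
    apply: cvg_big => [|z _]; first exact: add_continuous.
    by apply: cvgM; [exact: cvg_cst|exact: cF].
  have c2 : v x @[_ --> \oo] --> v x by exact: cvg_cst.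
  apply: (ler_cvg_to c1 c2); near=> n.
  apply: (@le_trans _ _ (F x (s + n%:R))).
    by apply: truncated_time_step_ge => //=; rewrite ?xZ ?ltW.
  by rewrite -lee_fin -mv truncated_time_le_mean// addr_ge0// ltW.
rewrite big_cons => step.
rewrite -(ler_pM2r s0).
have -> : \sum_(z <- Z) p x z s / s * v z = (\sum_(z <- Z) p x z s * v z) / s.
  by rewrite mulr_suml; apply: eq_bigr => z _; rewrite mulrAC.
set b := \sum_(z <- Z) p x z s * v z in step *.
have -> : (1 - p x x s) / s * v x * s = (1 - p x x s) * v x.
  by field; rewrite gt_eqF.
have -> : (p x x s + b / s) * s = s * p x x s + b by field; rewrite gt_eqF.
lra.
Unshelve. all: by end_near. Qed.

End absorption_time.

(** * Hitting times of an absorbing state *)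

(** Both sides are the product measure of the region under the graph of [C]. *)
Lemma ge0_integral_tail {R : realType} d (T : measurableType d)
    (P : probability T R) (C : T -> \bar R) :
  measurable_fun [set: T] C -> (forall w, 0 <= C w)%E ->
  (\int[P]_w C w =
   \int[lebesgue_measure]_(t in `[0%R, +oo[) P [set w | (t%:E < C w)%E])%E.
Proof.
move=> mC C0.
pose GR := measurableTypeR R.
pose A : set (T * GR) := [set z | 0 <= (z.2 : R) /\ ((z.2 : R)%:E < C z.1)%E].
have mA : measurable A.
  have -> : A = [set z | (0%:E <= (z.2 : R)%:E)%E] `&`
      [set z : T * GR | (0 < C z.1 - (z.2 : R)%:E)%E].
    have sg (a : R) (b : \bar R) : (0 < b - a%:E)%E = (a%:E < b)%E.
      exact: sube_gt0.
    apply/seteqP; split=> z [/= z0 zC]; split=> //=; first by rewrite (sg z.2).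
    by rewrite -(sg z.2).
  have m2 : measurable_fun [set: T * GR] (fun z : T * GR => (z.2 : R)%:E).
    by apply/measurable_EFinP; exact: measurable_snd.
  apply: measurableI.
    rewrite -[X in measurable X]setTI.
    exact: emeasurable_fun_c_infty.
  rewrite -[X in measurable X]setTI.
  apply: emeasurable_fun_o_infty => //; apply: emeasurable_funB => //.
  exact: measurableT_comp mC measurable_fst.
transitivity (\int[P]_w (\int[@lebesgue_measure R]_t (\1_A (w, t))%:E))%E.
  apply: eq_integral => w _.
  have -> : (fun t : GR => (\1_A (w, t))%:E : \bar R) =
      (fun t => (\1_[set` Interval (BLeft 0%R)
         (if C w is r%:E then BLeft r else +oo%O)] t)%:E).
    apply/funext => t; congr EFin; rewrite !indicE; congr (_ : bool)%:R.
    apply: asbool_equiv_eq; rewrite /A/= in_itv/=.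
    move: (C0 w); case: (C w) => [r| |]//= _; rewrite ?lte_fin ?ltry ?andbT.
      by split=> [[-> ->]|/andP[]].
    by split=> [[]|].
  rewrite integral_indic//= setIT lebesgue_measure_itv/=.
  move: (C0 w); case: (C w) => [r| |]//=; rewrite ?lee_fin ?lte_fin ?ltry//.
  - rewrite le_eqVlt => /predU1P[<-|->]; first by rewrite ltxx.
    by rewrite sube0.
rewrite (fubini_tonelli (fun z : T * GR => (\1_A z)%:E))//=; last first.
  exact/measurable_EFinP/measurable_indic.
rewrite [RHS]integral_mkcond/=; apply: eq_integral => t _; rewrite patchE.
have [t0|t0] := leP 0 t; last first.
  rewrite memNset/= ?in_itv/= ?leNgt ?t0//.
  apply: integral0_eq => w _; rewrite indicE memNset//= /A/=.
  by rewrite leNgt t0 => -[].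
rewrite mem_set/= ?in_itv/= ?t0//.
have -> : (fun w : T => (\1_A (w, t))%:E : \bar R) =
    (fun w => (\1_[set w | (t%:E < C w)%E] w)%:E).
  apply/funext => w; congr EFin; rewrite !indicE; congr (_ : bool)%:R.
  by apply: asbool_equiv_eq => /=; rewrite /A/= t0; split=> [[]|].
rewrite integral_indic//= ?setIT//.
by rewrite -[X in measurable X]setTI; exact: emeasurable_fun_o_infty.
Qed.

Section markov_process.
Context {R : realType} {S : countType} {d : measure_display}.
Context {T : measurableType d} {P : probability T R} {M : R -> T -> S}.
Context {p : S -> S -> R -> R} {x0 : S}.
Hypothesis ptf : transition_function p.
Hypothesis MP : markov_process P M p x0.

Lemma markov_two_times (s t : R) (x y : S) : 0 <= s -> s < t ->
  P ([set w | M s w = x] `&` [set w | M t w = y]) =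
  (P [set w | M s w = x] * (p x y (t - s))%:E)%E.
Proof.
move=> s0 st.
pose ts k := if k is 0%N then s else t; pose xs k := if k is 0%N then x else y.
have -> : [set w | M s w = x] `&` [set w | M t w = y] =
    [set w | forall k, (k <= 1)%N -> M (ts k) w = xs k].
  apply/seteqP; split=> w /=; first by move=> [Ms Mt] [|[|k]].
  by move=> Mst; split; [exact: (Mst 0%N)|exact: (Mst 1%N)].
have -> : [set w | M s w = x] =
    [set w | forall k, (k <= 0)%N -> M (ts k) w = xs k].
  by apply/seteqP; split=> w /=; [move=> Ms [|k]|move=> /(_ 0%N erefl)].
by rewrite (mc_markov MP)// => -[|k].
Qed.

Lemma probability_at (t : R) (y : S) : 0 <= t ->
  P [set w | M t w = y] = (p x0 y t)%:E.
Proof.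
have mM s x : 0 <= s -> measurable [set w | M s w = x].
  exact: (mc_measurable MP).
have full (A : set T) : measurable A -> P A = P ([set w | M 0 w = x0] `&` A).
  move=> mA; rewrite (measureDI P mA (mM 0 x0 (lexx 0))) setIC.
  rewrite -[RHS]add0e; congr (_ + _)%E.
  apply/eqP; rewrite -measure_le0//=.
  have <- : P (~` [set w | M 0 w = x0]) = 0%E.
    rewrite probability_setC; last exact: mM.
    by rewrite (mc_start MP) subee.
  apply: le_measure; rewrite ?inE.
  - by apply: measurableD => //; exact: mM.
  - by apply: measurableC; exact: mM.
  - by move=> w [].
rewrite le_eqVlt => /predU1P[<-|t0].
  rewrite full; last exact: mM.
  rewrite (tf_0 ptf); have [<-|x0y] := eqVneq x0 y.
    by rewrite setIid (mc_start MP).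
  rewrite (_ : _ `&` _ = set0) ?measure0//.
  by apply/seteqP; split=> // w /= [->] /eqP; rewrite (negbTE x0y).
rewrite full; last exact/mM/ltW.
by rewrite markov_two_times// (mc_start MP) mul1e subr0.
Qed.

Variable o : S.
Hypothesis o_absorbing : forall t, 0 <= t -> p o o t = 1.

Local Notation C := (hitting_time M o).

Lemma hitting_time_ge0 w : (0 <= C w)%E.
Proof. by apply: le_ereal_inf_tmp => _ [t [t0 _] <-]; rewrite lee_fin. Qed.

(** By right-continuity a visit to [o] before [t] is seen at a rational time,
    and if [M t w != o] there is no visit just after [t] either. *)
Lemma hitting_time_gtE (t : R) : 0 <= t ->
  [set w | (t%:E < C w)%E] = [set w | M t w <> o] `\`
    \bigcup_(r : rat) [set w | 0 < (ratr r : R) < t /\ M (ratr r) w = o].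
Proof.
move=> t0; apply/seteqP; split=> w /=.
  move=> tC; have not_before s : 0 <= s -> s <= t -> M s w <> o.
    move=> s0 st Ms; move: tC; rewrite ltNge => /negP; apply.
    apply: (@le_trans _ _ s%:E); last by rewrite lee_fin.
    by apply: ereal_inf_lbound; exists s.
  split; first exact: not_before.
  by move=> [r _ /= [/andP[r0 rt]]]; apply: not_before; exact: ltW.
move=> [Mt Mr].
have [e /= e0 eP] := mc_right_continuous MP w t0.
apply: (@lt_le_trans _ _ (t + e)%:E); first by rewrite lte_fin ltrDl.
apply: le_ereal_inf_tmp => _ [s [s0 Ms] <-].
rewrite lee_fin leNgt; apply/negP => ste.
have [st|ts|ts] := ltgtP s t; last by rewrite -ts in Mt.
  have [e' /= e'0 e'P] := mc_right_continuous MP w s0.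
  have [r] : exists r : rat, ratr r \in `]s, (Num.min t (s + e'))[.
    by apply: rat_in_itvoo; rewrite lt_min st ltrDl.
  rewrite in_itv/= lt_min => /and3P[sr rt re].
  apply: Mr; exists r => //=; split; first by rewrite rt (le_lt_trans s0 sr).
  rewrite -[RHS]Ms; apply: e'P => //=.
  by rewrite /ball_/= distrC gtr0_norm ?subr_gt0// ltrBlDl.
apply: Mt; rewrite -Ms; apply/esym/eP => //=.
by rewrite distrC gtr0_norm ?subr_gt0// ltrBlDl.
Qed.

Let measurable_at t x : 0 <= t -> measurable [set w | M t w = x].
Proof. exact: (mc_measurable MP). Qed.

Lemma measurable_hit_before (t : R) (r : rat) :
  measurable [set w | 0 < (ratr r : R) < t /\ M (ratr r) w = o].
Proof.
have [/andP[r0 rt]|rt] := boolP (0 < (ratr r : R) < t).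
  rewrite (_ : [set _ | _] = [set w | M (ratr r) w = o]).
    exact/measurable_at/ltW.
  by apply/seteqP; split=> w /= [].
rewrite (_ : [set _ | _] = set0)//.
by apply/seteqP; split=> w /= [].
Qed.

Lemma measurable_alive (t : R) : 0 <= t -> measurable [set w | M t w <> o].
Proof. by move=> t0; apply: measurableC; exact: measurable_at. Qed.

Lemma measurable_hitting_time : measurable_fun [set: T] C.
Proof.
apply: (measurability _ (ErealGenOInfty.measurableE R)) => _ [_ [t ->] <-].
rewrite setTI (_ : _ @^-1` _ = [set w | (t%:E < C w)%E]); last first.
  by apply/seteqP; split=> w /=; rewrite in_itv/= andbT.
have [t0|t0] := leP 0 t; last first.
  rewrite (_ : [set _ | _] = setT)//; apply/seteqP; split=> // w _ /=.
  by apply: lt_le_trans (hitting_time_ge0 w); rewrite lte_fin.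
rewrite hitting_time_gtE//; apply: measurableD; first exact: measurable_alive.
by apply: bigcupT_measurable_rat => r; exact: measurable_hit_before.
Qed.

(** The events removed from [M t w <> o] in [hitting_time_gtE] are null: once in
    [o] at a rational time before [t], the process is almost surely in [o] at
    [t]. *)
Lemma probability_hitting_time_gt (t : R) : 0 <= t ->
  P [set w | (t%:E < C w)%E] = (survival p o x0 t)%:E.
Proof.
move=> t0; rewrite survivalE// EFinB -(probability_at o t0).
rewrite -probability_setC; last exact: measurable_at.
rewrite hitting_time_gtE//; apply/esym.
set A := ~` _; set B := \bigcup__ _.
have mA : measurable A by exact: measurable_alive.
have mB : measurable B.
  by apply: bigcupT_measurable_rat => r; exact: measurable_hit_before.
rewrite (measureDI P mA mB) -[RHS]adde0; congr (_ + _)%E.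
apply: measure_negligible; first exact: measurableI.
pose E n := [set w | M t w <> o] `&`
  [set w | 0 < (ratr (odflt 0%Q (unpickle n)) : R) < t /\
           M (ratr (odflt 0%Q (unpickle n))) w = o].
apply: (@negligibleS _ _ _ _ (\bigcup_n E n)).
  move=> w [Aw [r _ Br]]; exists (pickle r) => //.
  by rewrite /E pickleK.
apply: negligible_bigcup => n; rewrite /E; move: (odflt _ _) => r.
apply/negligibleP.
  by apply: measurableI; [exact: measurable_alive|exact: measurable_hit_before].
have [/andP[r0 rt]|rt] := boolP (0 < (ratr r : R) < t); last first.
  rewrite (_ : _ `&` _ = set0) ?measure0//.
  by apply/seteqP; split=> // w /= [_ []].
have mr := measurable_at o (ltW r0).
have mt := measurable_at o t0.
rewrite (_ : _ `&` _ = [set w | M (ratr r) w = o] `\` [set w | M t w = o]).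
  rewrite measureD//; last by rewrite ltey_eq fin_num_measure.
  rewrite [X in (_ - X)%E](markov_two_times _ _ (ltW r0) rt).
  by rewrite o_absorbing ?subr_ge0 ?ltW// mule1 subee// fin_num_measure.
apply/seteqP; split=> w /=; first by move=> [Mt [_ Mr]].
by move=> [Mr Mt]; split=> //; split=> //; apply/andP.
Qed.

Lemma mean_hitting_time :
  (\int[P]_w C w)%E = mean_time p o x0.
Proof.
rewrite ge0_integral_tail//; last 2 first.
- exact: measurable_hitting_time.
- exact: hitting_time_ge0.
apply: eq_integral => t; rewrite inE/= in_itv/= andbT.
exact: probability_hitting_time_gt.
Qed.

End markov_process.

(** * Queues with resurrection and catastrophes *)

(** For [i >= 1], the total rate out of [i], catastrophes excluded. *)
Definition departure_rate {R : realType} (c : nat) (b : nat -> R) (i : nat)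
    : R :=
  - b 1%N + ((minn i c)%:R - 1) * b 0%N.

(** For [i >= 1], the rate from [i] to 0: a queue empties by a service only from
    length 1. *)
Definition emptying_rate {R : realType} (b : nat -> R) (i : nat) : R :=
  if i == 1%N then b 0%N else 0.

(** A bound of order [1 / beta] on the mean catastrophe times from all the busy
    states [i >= 1], for [beta > b 0]. *)
Definition busy_bound {R : realType} (b : nat -> R) (hsum beta : R) : R :=
  (1 + b 0%N / hsum) / (beta - b 0%N).

Section queue.
Context {R : realType} {c : nat} {b h : nat -> R} {hsum beta : R}.
Hypothesis c_ge1 : (1 <= c)%N.
Hypothesis b0_gt0 : 0 < b 0%N.
Hypothesis b01 : b 0%N <= - b 1%N.
Hypothesis hsum_gt0 : 0 < hsum.
Hypothesis beta_gt : b 0%N < beta.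

Context {p : option nat -> option nat -> R -> R}.
Hypothesis ptf : transition_function p.
Let q := catastrophe_q c b h hsum beta.
Hypothesis pq : has_q_matrix p q.

Local Notation F := (truncated_time p None).
Local Notation m := (mean_time p None).
Local Notation r := (departure_rate c b).
Local Notation e := (emptying_rate b).
Local Notation B := (busy_bound b hsum beta).

Lemma emptying_rate_bound i : 0 <= e i <= b 0%N.
Proof. by rewrite /emptying_rate; case: ifP; rewrite ?lexx ltW. Qed.

Lemma emptying_rate_le_departure i : (1 <= i)%N -> e i <= r i.
Proof.
move=> i1; have /andP[_ ei] := emptying_rate_bound i.
have : 0 <= ((minn i c)%:R - 1) * b 0%N.
  apply: mulr_ge0; last exact: ltW.
  by rewrite subr_ge0 ler1n leq_min i1.
by move=> k0; apply: (le_trans ei); rewrite -[leLHS]addr0 lerD.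
Qed.

Lemma departure_rate_le i : r i <= - b 1%N + c%:R * b 0%N.
Proof.
rewrite /departure_rate lerD2l (ler_wpM2r (ltW b0_gt0))//.
by rewrite lerBlDr (le_trans _ (_ : c%:R <= _))// ?ler_nat ?geq_minr// lerDl.
Qed.

Lemma q_catastrophe i : (1 <= i)%N -> q (Some i) None = beta.
Proof. by case: i. Qed.

Lemma q_exit i : (1 <= i)%N -> - q (Some i) (Some i) = r i + beta.
Proof.
case: i => // i _; rewrite /q /= eqxx /resurrection_q /=.
by rewrite (gtn_eqF (ltnSn _)) eqxx /departure_rate; ring.
Qed.

Lemma q_empty i : (1 <= i)%N -> q (Some i) (Some 0%N) = e i.
Proof.
case: i => [//|[|i]] _ //.
transitivity ((minn 1 c)%:R * b 0%N); first by [].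
by rewrite (minn_idPl c_ge1) mul1r.
Qed.

Lemma q_exit0 : - q (Some 0%N) (Some 0%N) = hsum.
Proof. by rewrite /q /resurrection_q /= subr0 opprK. Qed.

Lemma catastrophe_absorbing t : 0 <= t -> p None None t = 1.
Proof. by apply: (transition_absorbing ptf); exact: (@pq None None). Qed.

Let F_bound := truncated_time_bound ptf catastrophe_absorbing.

(** From 0 the chain waits a mean time [1 / hsum] and then enters a busy
    state. *)
Lemma truncated_time_empty_le (u U : R) : 0 <= u -> 0 <= U ->
  (forall i, (1 <= i)%N -> F (Some i) u <= U) ->
  F (Some 0%N) u <= hsum^-1 + U.
Proof.
move=> u0 U0 FU.
have := @truncated_time_generator_le _ _ _ _ ptf pq _ catastrophe_absorbing
  (Some 0%N) [:: None] u U erefl erefl u0 U0.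
rewrite !big_seq1 q_exit0 (_ : q (Some 0%N) None = 0)// mul0r addr0 subr0.
move=> step; rewrite -(ler_pM2l hsum_gt0) mulrDr divff ?gt_eqF//.
by apply: step => -[[//|i] _ _|//]; exact: FU.
Qed.

(** The two states singled out are the catastrophe state, where the remaining
    time is 0, and the empty queue, where it may exceed [U]. *)
Lemma truncated_time_busy_le (u U : R) (i : nat) : 0 <= u -> 0 <= U ->
  (forall k, (1 <= k)%N -> F (Some k) u <= U) -> (1 <= i)%N ->
  (r i + beta) * F (Some i) u <= 1 + e i * F (Some 0%N) u + (r i - e i) * U.
Proof.
move=> u0 U0 FU i1.
have := @truncated_time_generator_le _ _ _ _ ptf pq _ catastrophe_absorbing
  (Some i) [:: None; Some 0%N] u U erefl.
rewrite !big_cons !big_nil q_exit// q_catastrophe// q_empty// !addr0.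
rewrite (truncated_time_absorbing catastrophe_absorbing u0) mulr0 add0r.
rewrite (_ : r i + beta - (beta + e i) = r i - e i); last by ring.
apply=> //; first by rewrite !inE/=; case: i i1.
by move=> [[//|k] _ _|//]; exact: FU.
Qed.

(** Where the supremum [U] over the busy states is almost attained, jumps among
    these states cannot increase the remaining time by much, so only
    catastrophes and the passage through 0 count: [beta * U <= 1 + b 0 * F 0]. Inserting
    [F 0 <= 1 / hsum + U] bounds [U] by [(1 + b 0 / hsum) / (beta - b 0)],
    whatever the horizon [u]. *)
Lemma truncated_time_busy_bound (u : R) (i : nat) : 0 <= u -> (1 <= i)%N ->
  F (Some i) u <= B.
Proof.
move: (b0_gt0) (beta_gt) => b0 betab u0 i1.
pose E := [set F (Some k) u | k in [set k | (1 <= k)%N]].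
have ubE : has_ubound E.
  by exists u => _ [k _ <-]; have /andP[] := F_bound (Some k) u0.
pose U := sup E.
have FU k : (1 <= k)%N -> F (Some k) u <= U.
  by move=> k1; apply: ub_le_sup => //; exists k.
have F0 x : 0 <= F x u by have /andP[] := F_bound x u0.
have U0 : 0 <= U by apply: le_trans (FU _ i1).
have F0U := truncated_time_empty_le u0 U0 FU.
(* The departure rates are bounded uniformly in [k], since there are only [c]
   servers; this makes [r k * (U - F (Some k) u)] small when [F (Some k) u] is
   close to [U]. *)
have [K K0 rK] : exists2 K : R, 0 <= K & forall k, r k <= K.
  exists (- b 1%N + c%:R * b 0%N); last exact: departure_rate_le.
  have /andP[e0 _] := emptying_rate_bound i.
  apply: le_trans (departure_rate_le i).
  exact: le_trans e0 (emptying_rate_le_departure i1).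
have UK : U <= (1 + b 0%N * F (Some 0%N) u + K * U) / (beta + K).
  apply: ge_sup; first by exists (F (Some i) u), i.
  move=> _ [k k1 <-]; rewrite ler_pdivlMr; last by lra.
  have := truncated_time_busy_le u0 U0 FU k1.
  have /andP[e0 eb] := emptying_rate_bound k.
  have : r k * (U - F (Some k) u) <= K * (U - F (Some k) u).
    by rewrite ler_wpM2r// subr_ge0 FU.
  have : e k * F (Some 0%N) u <= b 0%N * F (Some 0%N) u by rewrite ler_wpM2r.
  have : 0 <= e k * U by rewrite mulr_ge0.
  lra.
apply: (le_trans (FU _ i1)).
rewrite ler_pdivlMr in UK; last by lra.
rewrite /busy_bound ler_pdivlMr; last by lra.
have : b 0%N * F (Some 0%N) u <= b 0%N * (hsum^-1 + U) by rewrite ler_pM2l.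
lra.
Qed.

Lemma busy_bound_ge0 : 0 <= B.
Proof.
apply: divr_ge0; last by rewrite subr_ge0 ltW.
by apply: addr_ge0 => //; apply: divr_ge0; exact: ltW.
Qed.

Lemma truncated_time_empty_bound (u : R) : 0 <= u ->
  F (Some 0%N) u <= hsum^-1 + B.
Proof.
move=> u0; apply: truncated_time_empty_le => // [|i i1].
  exact: busy_bound_ge0.
exact: truncated_time_busy_bound.
Qed.

Lemma mean_time_fin_num x : m x \is a fin_num.
Proof.
have fin (C : R) : (forall u, 0 <= u -> F x u <= C) -> m x \is a fin_num.
  move=> FC; rewrite ge0_fin_numE; last first.
    apply: integral_ge0 => t _; rewrite lee_fin.
    exact: survival_ge0.
  apply: le_lt_trans (ltry C).
  exact: (mean_time_le ptf catastrophe_absorbing).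
case: x fin => [[|i]|] fin.
- by apply: (fin (hsum^-1 + B)) => u u0; exact: truncated_time_empty_bound.
- by apply: (fin B) => u u0; exact: truncated_time_busy_bound.
- by apply: (fin 0) => u u0; rewrite (truncated_time_absorbing catastrophe_absorbing).
Qed.

(** The lower bound is the mean of the waiting time in 0 alone. *)
Lemma mean_time_empty_bounds :
  ((hsum^-1)%:E <= m (Some 0%N) <= (hsum^-1 + B)%:E)%E.
Proof.
apply/andP; split; last first.
  apply: (mean_time_le ptf catastrophe_absorbing).
  exact: truncated_time_empty_bound.
have := @mean_time_generator_ge _ _ _ _ ptf pq None catastrophe_absorbing
  (Some 0%N) [::] (fine \o m) erefl erefl erefl.
rewrite big_nil addr0 q_exit0 => /(_ _)/= hm.
rewrite -[m _]fineK ?mean_time_fin_num// lee_fin.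
rewrite -(ler_pM2l hsum_gt0) divff ?gt_eqF//.
by apply: hm => z; rewrite fineK ?mean_time_fin_num.
Qed.

(** Of the jumps out of [i], the lower bound keeps only the one to 0, from which
    at least [1 / hsum] remains; the upper bound replaces the remaining time by
    [hsum^-1 + B] in 0 and by [B] in the busy states. *)
Lemma mean_time_busy_bounds (i : nat) : (1 <= i)%N ->
  ((beta * (1 + e i / hsum) / (r i + beta))%:E <= beta%:E * m (Some i)
     <= (1 + e i / hsum + r i * B)%:E)%E.
Proof.
move: (b0_gt0) (beta_gt) => b0 betab i1.
have /andP[e0 eb] := emptying_rate_bound i.
have er := emptying_rate_le_departure i1.
have beta0 : 0 < beta by lra.
have rb : 0 < r i + beta by lra.
rewrite -[m _]fineK ?mean_time_fin_num// -EFinM !lee_fin; apply/andP; split.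
  have := @mean_time_generator_ge _ _ _ _ ptf pq None catastrophe_absorbing
    (Some i) [:: Some 0%N] (fine \o m) erefl erefl.
  rewrite big_seq1 q_exit// q_empty// inE => step.
  rewrite -mulrA ler_pM2l// ler_pdivrMr//.
  apply: (@le_trans _ _ (1 + e i * fine (m (Some 0%N)))).
    rewrite lerD2l ler_wpM2l// -lee_fin fineK ?mean_time_fin_num//.
    by have /andP[] := mean_time_empty_bounds.
  rewrite [leRHS]mulrC; apply: step; first by case: i i1 {e0 eb er rb}.
  by move=> z; rewrite fineK ?mean_time_fin_num.
suff : (m (Some i) <= ((1 + e i / hsum + r i * B) / beta)%:E)%E.
  by rewrite -[m _]fineK ?mean_time_fin_num// lee_fin ler_pdivlMr// mulrC.
apply: (mean_time_le ptf catastrophe_absorbing) => u u0.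
have := truncated_time_busy_le u0 busy_bound_ge0
  (fun k => truncated_time_busy_bound u0) i1.
have Fi := truncated_time_busy_bound u0 i1.
have F0 := truncated_time_empty_bound u0.
have /andP[Fi0 _] := F_bound (Some i) u0.
rewrite ler_pdivlMr//.
have : e i * F (Some 0%N) u <= e i * (hsum^-1 + B) by rewrite ler_wpM2l.
have : 0 <= r i * F (Some i) u by rewrite mulr_ge0//; lra.
lra.
Qed.

End queue.

Lemma cvg_inv_shift {R : realType} (a : R) :
  (beta + a)^-1 @[beta --> +oo] --> (0 : R).
Proof.
have cy : beta + a @[beta --> +oo] --> +oo by exact: cvg_addrr.
apply/gtr0_cvgV0 => //.
by have /cvgryPgt := cy; apply.
Qed.

Lemma cvg_busy_bound {R : realType} (b : nat -> R) (hsum : R) :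
  busy_bound b hsum beta @[beta --> +oo] --> (0 : R).
Proof.
rewrite -(mulr0 (1 + b 0%N / hsum)); apply: cvgM; first exact: cvg_cst.
exact: cvg_inv_shift.
Qed.

Theorem theorem4p8 (R : realType) (c : nat) (b h : nat -> R) (hsum : R)
  (c_ge1 : (1 <= c)%N)
  (b_ge0 : forall j, j != 1%N -> 0 <= b j)
  (b1_lt0 : 0 < - b 1%N)
  (b_sum : (\sum_(0 <= j <oo | j != 1%N) (b j)%:E)%E = (- b 1%N)%:E)
  (b0_gt0 : 0 < b 0%N)
  (b_ge2_gt0 : (0 < \sum_(2 <= j <oo) (b j)%:E)%E)
  (h_ge0 : forall j, (1 <= j)%N -> 0 <= h j)
  (h_sum : (\sum_(1 <= j <oo) (h j)%:E)%E = hsum%:E)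
  (hsum_gt0 : 0 < hsum)
  (d : R -> nat -> measure_display)
  (T : forall (beta : R) (j : nat), measurableType (d beta j))
  (P : forall (beta : R) (j : nat), probability (T beta j) R)
  (M : forall (beta : R) (j : nat), R -> T beta j -> option nat)
  (M_chain : forall (beta : R) (j : nat), 0 < beta ->
    markov_chain (catastrophe_q c b h hsum beta) (P beta j) (M beta j)
      (Some j)) :
  let EC (j : nat) (beta : R) : \bar R :=
    (\int[P beta j]_w hitting_time (M beta j) None w)%E in
  (EC 0%N beta @[beta --> +oo] --> (1 / hsum)%:E) /\
  (forall j : nat, (1 <= j)%N ->
    (beta%:E * EC j beta)%E @[beta --> +oo] -->
      (if j == 1%N then 1 + b 0%N / hsum else 1)%:E).
Proof.
move=> EC.
have b01 : b 0%N <= - b 1%N.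
  rewrite -lee_fin -b_sum.
  have := @nneseries_lim_ge R (fun j => (b j)%:E) (fun j => j != 1%N) 0%N 1%N.
  rewrite big_mkcond big_nat1/=; apply=> j _ j1.
  by rewrite lee_fin b_ge0.
have EC_mean j beta : 0 < beta -> exists p : option nat -> option nat -> R -> R,
    [/\ transition_function p, has_q_matrix p (catastrophe_q c b h hsum beta) &
        EC j beta = mean_time p None (Some j)].
  move=> beta0; have [p [ptf pq MP]] := M_chain beta j beta0.
  exists p; split=> //; apply: (mean_hitting_time ptf MP).
  exact: catastrophe_absorbing ptf pq.
have cB := cvg_busy_bound b hsum.
split=> [|j j1].
- apply: (@squeeze_cvge _ _ _ _ (fun=> (hsum^-1)%:E) _
    (fun beta => (hsum^-1 + busy_bound b hsum beta)%:E)).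
  + near=> beta.
    have beta_gt : b 0%N < beta by near: beta; exact/nbhs_pinfty_gt/num_real.
    have [p [ptf pq ->]] := EC_mean 0%N beta (lt_trans b0_gt0 beta_gt).
    exact: (mean_time_empty_bounds c_ge1 b0_gt0 b01 hsum_gt0 beta_gt ptf pq).
  + by rewrite div1r; exact: cvg_cst.
  + apply: cvg_EFin; first exact: nearW.
    rewrite div1r -[X in _ --> X]addr0.
    by apply: cvgD => //; exact: cvg_cst.
- have -> : (if j == 1%N then 1 + b 0%N / hsum else 1) =
      1 + emptying_rate b j / hsum.
    by rewrite /emptying_rate; case: ifP; rewrite ?mul0r ?addr0.
  set x := emptying_rate b j / hsum.
  set r := departure_rate c b j.
  apply: (@squeeze_cvge _ _ _ _ (fun beta => (beta * (1 + x) / (r + beta))%:E) _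
    (fun beta => (1 + x + r * busy_bound b hsum beta)%:E)).
  + near=> beta.
    have beta_gt : b 0%N < beta by near: beta; exact/nbhs_pinfty_gt/num_real.
    have [p [ptf pq ->]] := EC_mean j beta (lt_trans b0_gt0 beta_gt).
    exact: (mean_time_busy_bounds c_ge1 b0_gt0 b01 hsum_gt0 beta_gt ptf pq j1).
  + apply: cvg_EFin; first exact: nearW.
    have lim : (1 + x) - (1 + x) * r * (beta + r)^-1 @[beta --> +oo] --> 1 + x.
      rewrite -[X in _ --> X]subr0 -(mulr0 ((1 + x) * r)).
      apply: cvgB; first exact: cvg_cst.
      by apply: cvgM; [exact: cvg_cst|exact: cvg_inv_shift].
    apply: cvg_trans lim; apply: near_eq_cvg; near=> beta => /=.
    have br : 0 < beta + r by near: beta; have /cvgryPgt := @cvg_addrr R r; apply.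
    by field; rewrite addrC gt_eqF.
  + apply: cvg_EFin; first exact: nearW.
    rewrite -[X in _ --> X]addr0 -(mulr0 r).
    apply: cvgD; first exact: cvg_cst.
    by apply: cvgM; [exact: cvg_cst|].
Unshelve. all: by end_near. Qed.
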